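(* Let $p\ge1$ and let $U^p(\Omega)$ be an $H^1$-conforming polynomial basis on the unit tetrahedron $\Omega$, split into vertex, edge, face and cell base functions $\mathcal V^p_i,\mathcal E^p_j,\mathcal F^p_k,\mathcal C^p_{1234}$. Write $\mathbf s=\mathbf e_1+\mathbf e_2+\mathbf e_3$ and consider the polytopal template $$\mathcal T_1=\{\mathbf e_3,\mathbf e_2,\mathbf e_1\},\ \mathcal T_2=\{\mathbf s,\mathbf e_2,\mathbf e_1\},\ \mathcal T_3=\{\mathbf s,-\mathbf e_3,\mathbf e_1\},\ \mathcal T_4=\{\mathbf s,-\mathbf e_3,-\mathbf e_2\},$$ $$\mathcal T_{12}=\{\mathbf e_3,-\mathbf e_2,-\mathbf e_1\},\ \mathcal T_{13}=\{\mathbf e_2,\mathbf e_3,-\mathbf e_1\},\ \mathcal T_{14}=\{\mathbf e_1,\mathbf e_3,\mathbf e_2\},$$ $$\mathcal T_{23}=\{\mathbf e_2,\mathbf s,-\mathbf e_1\},\ \mathcal T_{24}=\{\mathbf e_1,\mathbf s,\mathbf e_2\},\ \mathcal T_{34}=\{\mathbf e_1,\mathbf s,-\mathbf e_3\},$$ $$\mathcal T_{123}=\{\mathbf e_3,\mathbf e_2,-\mathbf e_1\},\ \mathcal T_{124}=\{\mathbf e_3,\mathbf e_1,\mathbf e_2\},\ \mathcal T_{134}=\{\mathbf e_2,\mathbf e_1,-\mathbf e_3\},\ \mathcal T_{234}=\{\mathbf e_2,\mathbf e_1,\mathbf s\},\ \mathcal T_{1234}=\{\mathbf e_3,\mathbf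 e_2,\mathbf e_1\}.$$ Then the tensor product of the basis with the template, $$\Big\{\bigoplus_{i=1}^4\mathcal V_i^p\otimes\mathcal T_i\Big\}\oplus\Big\{\bigoplus_{j\in\mathcal J}\mathcal E^p_j\otimes\mathcal T_j\Big\}\oplus\Big\{\bigoplus_{k\in\mathcal K}\mathcal F^p_k\otimes\mathcal T_k\Big\}\oplus\{\mathcal C^p_{1234}\otimes\mathcal T_{1234}\},$$ with $\mathcal J=\{(1,2),(1,3),(1,4),(2,3),(2,4),(3,4)\}$ and $\mathcal K=\{(1,2,3),(1,2,4),(1,3,4),(2,3,4)\}$, yields a unisolvent Nédélec element of the second type $\mathcal N_{II}^p(\Omega)$.
   Context: $\Omega=\{(\xi,\eta,\zeta)\in[0,1]^3\mid \xi+\eta+\zeta\le1\}$ has vertices $v_1=(0,0,0)$, $v_2=(0,0,1)$, $v_3=(0,1,0)$, $v_4=(1,0,0)$, edges $e_{ij}$ joining $v_i,v_j$, faces $f_{ijk}$ with vertices $v_i,v_j,v_k$, and cell $c_{1234}$ (its interior). $\mathbf e_1,\mathbf e_2,\mathbf e_3$ is the Cartesian basis. $P^p(\Omega)$ denotes the polynomials of total degree at most $p$. $H^1$-conforming polynomial basis $U^p(\Omega)$: linearly independent polynomials in $P^p(\Omega)$ with $\dim U^p(\Omega)=\dim P^p(\Omega)=(p+3)(p+2)(p+1)/6$, each associated with one polytope: one vertex base function per vertex ($\mathcal V^p_i$), $p-1$ edge base functions per edge ($\mathcal E^p_j$), $(p-2)(p-1)/2$ face base functions per face ($\mathcal F^p_k$),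 and $(p-3)(p-2)(p-1)/6$ cell base functions ($\mathcal C^p_{1234}$). A vertex base function vanishes at all other vertices and on non-neighbouring edges and faces; an edge base function vanishes on all other edges and non-neighbouring faces; a face base function vanishes on all other faces; a cell base function vanishes on the whole boundary. $\mathcal S\otimes\mathcal T_\ast$ denotes all products $n\,\boldsymbol\ell$ with $n\in\mathcal S$, $\boldsymbol\ell\in\mathcal T_\ast$. ''Unisolvent Nédélec element of the second type'' means: the vectorial base functions so obtained are linearly independent and form a basis of the Nédélec space of the second type, whose polynomial space on $\Omega$ is $[P^p(\Omega)]^3$. *)

(* Defs.v *)
From HB Require Import structures.
From mathcomp Require Import all_boot all_order all_algebra.
From mathcomp Require Import reals.
From mathcomp Require Import mpoly.
From mathcomp Require Import zify ring lra.
Set Implicit Arguments.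
Unset Strict Implicit.
Unset Printing Implicit Defensive.
Import Order.TTheory GRing.Theory Num.Theory.
Local Open Scope ring_scope.

Inductive polytope : Type :=
  | V1 | V2 | V3 | V4
  | E12 | E13 | E14 | E23 | E24 | E34
  | F123 | F124 | F134 | F234
  | C1234.

(* The indices in {1, 2, 3, 4} of the vertices of a polytope. *)
Definition labels (t : polytope) : seq nat :=
  match t with
  | V1 => [:: 1] | V2 => [:: 2] | V3 => [:: 3] | V4 => [:: 4]
  | E12 => [:: 1; 2] | E13 => [:: 1; 3] | E14 => [:: 1; 4]
  | E23 => [:: 2; 3] | E24 => [:: 2; 4] | E34 => [:: 3; 4]
  | F123 => [:: 1; 2; 3] | F124 => [:: 1; 2; 4]
  | F134 => [:: 1; 3; 4] | F234 => [:: 2; 3; 4]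
  | C1234 => [:: 1; 2; 3; 4]
  end%N.

Definition polytopes : seq polytope :=
  [:: V1; V2; V3; V4; E12; E13; E14; E23; E24; E34;
      F123; F124; F134; F234; C1234].

Lemma labelsK :
  pcancel labels (fun s => ohead [seq t <- polytopes | labels t == s]).
Proof. by case. Qed.

HB.instance Definition _ := Countable.copy polytope (pcan_type labelsK).

Lemma polytopes_enumP : Finite.axiom polytopes.
Proof. by case. Qed.

HB.instance Definition _ := isFinite.Build polytope polytopes_enumP.

Definition is_vertex (t : polytope) : bool := size (labels t) == 1%N.
Definition is_edge (t : polytope) : bool := size (labels t) == 2.
Definition is_face (t : polytope) : bool := size (labels t) == 3.
Definition is_cell (t : polytope) : bool := size (labels t) == 4.

(* [s] neighbours the higher-dimensional polytope [t] when it lies in the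
   closure of [t]. *)
Definition neighbouring (s t : polytope) : bool :=
  all (fun i => i \in labels t) (labels s).

Section Geometry.
Variable R : realType.

Definition vec3 (a b c : R) : 'rV[R]_3 := \row_j [:: a; b; c]`_j.

Definition e1 : 'rV[R]_3 := vec3 1 0 0.
Definition e2 : 'rV[R]_3 := vec3 0 1 0.
Definition e3 : 'rV[R]_3 := vec3 0 0 1.

(* Only the indices 1, 2, 3, 4 are meaningful. *)
Definition vertex (i : nat) : 'rV[R]_3 :=
  match i with
  | 2 => vec3 0 0 1
  | 3 => vec3 0 1 0
  | 4 => vec3 1 0 0
  | _ => vec3 0 0 0
  end%N.

Definition Omega (x : 'rV[R]_3) : Prop :=
  (forall j, 0 <= x 0 j <= 1) /\ \sum_j x 0 j <= 1.

(* The closed polytope: the convex hull of its vertices.  As polynomials are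
   continuous, vanishing on it is the same as vanishing on its relative
   interior. *)
Definition in_polytope (t : polytope) (x : 'rV[R]_3) : Prop :=
  exists lam : nat -> R,
    [/\ forall i, 0 <= lam i,
        \sum_(i <- labels t) lam i = 1
      & x = \sum_(i <- labels t) lam i *: vertex i].

Lemma in_cellE (x : 'rV[R]_3) : in_polytope C1234 x <-> Omega x.
Proof.
have sum3 (F : 'I_3 -> R) : \sum_j F j = F 0 + F 1 + F 2%:R.
  rewrite !big_ord_recl big_ord0 addr0 addrA.
  by congr (F _ + F _ + F _); apply/val_inj.
have ex (lam : nat -> R) j : (\sum_(i <- labels C1234) lam i *: vertex i) 0 j
    = [:: lam 4; lam 3; lam 2]`_j.
  rewrite /labels !big_cons big_nil !mxE.
  by case: j => -[|[|[|//]]] ? /=; rewrite !(mulr0, mulr1, add0r, addr0).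
split=> [[lam [lam0 lam1 ->]]|[x01 xs]].
  rewrite /labels !big_cons big_nil addr0 in lam1.
  have := lam0 1%N; have := lam0 2; have := lam0 3; have := lam0 4.
  split=> [j|]; last by rewrite sum3 !ex /=; lra.
  by rewrite ex; case: j => -[|[|[|//]]] ? /=; lra.
pose lam (i : nat) : R := match i with
  | 1%N => 1 - \sum_j x 0 j | 2 => x 0 2%:R
  | 3 => x 0 1 | 4 => x 0 0 | _ => 0 end.
exists lam; split.
- case=> [|[|[|[|[|i]]]]] //=; rewrite ?subr_ge0 //;
    by case/andP: (x01 0); case/andP: (x01 1); case/andP: (x01 2%:R).
- by rewrite /labels !big_cons big_nil /= sum3; ring.
- apply/rowP => j; rewrite ex.
  by case: j => -[|[|[|//]]] ? /=; congr (x _ _); apply/val_inj.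
Qed.

End Geometry.

(* For [0 < p] the truncated subtractions agree with those in the integers:
   one factor is [0] whenever another one would be negative. *)
Definition nb_base (p : nat) (t : polytope) : nat :=
  (if is_vertex t then 1
   else if is_edge t then p - 1
   else if is_face t then ((p - 2) * (p - 1)) %/ 2
   else ((p - 3) * (p - 2) * (p - 1)) %/ 6)%N.

Definition base_index (p : nat) : finType :=
  {t : polytope & 'I_(nb_base p t)}.

Lemma card_base_index (p : nat) : (0 < p)%N ->
  #|base_index p| = (((p + 3) * (p + 2) * (p + 1)) %/ 6)%N.
Proof.
case: p => // q _.
have -> : (((q.+1 + 3) * (q.+1 + 2) * (q.+1 + 1)) %/ 6 = 'C(q.+4, 3))%N.
  by rewrite bin_ffactd !ffactnS ffactn0 muln1 mulnA !addnS !addn0.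
have -> : #|base_index q.+1| =
    sumn [seq nb_base q.+1 t | t <- polytopes].
  have eP : enum {: polytope} = polytopes by rewrite enumT unlock.
  rewrite card_tagged eP; congr sumn; apply: eq_map => t.
  exact: card_ord.
rewrite /= /nb_base /=.
have -> : (((q.+1 - 2) * (q.+1 - 1)) %/ 2 = 'C(q, 2))%N.
  rewrite bin_ffactd !ffactnS ffactn0 muln1; congr (_ %/ _)%N; lia.
have -> : (((q.+1 - 3) * (q.+1 - 2) * (q.+1 - 1)) %/ 6 = 'C(q, 3))%N.
  rewrite bin_ffactd !ffactnS ffactn0 muln1; congr (_ %/ _)%N; lia.
rewrite !binS !bin0 !bin1; lia.
Qed.

Section Bases.
Variable R : realType.

Definition lin_indep (V : lmodType R) (I : finType) (v : I -> V) : Prop :=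
  forall c : I -> R, \sum_i c i *: v i = 0 -> forall i, c i = 0.

Definition basis_of (V : lmodType R) (W : V -> Prop)
    (I : finType) (v : I -> V) : Prop :=
  [/\ forall i, W (v i),
      lin_indep v
    & forall w, W w -> exists c : I -> R, w = \sum_i c i *: v i].

(* [msize q] is the total degree of [q] plus one, and [msize 0 = 0]. *)
Definition in_P (p : nat) (q : {mpoly R[3]}) : Prop := (msize q <= p.+1)%N.

Definition vanishes_on (q : {mpoly R[3]}) (t : polytope) : Prop :=
  forall x : 'rV[R]_3, in_polytope t x -> q.@[fun j => x 0 j] = 0.

(* [U t] enumerates the base functions associated with the polytope [t]. *)
Record H1_basis (p : nat)
    (U : forall t : polytope, 'I_(nb_base p t) -> {mpoly R[3]}) : Prop := {
  H1_degree : forall t m, in_P p (U t m);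
  H1_lin_indep :
    lin_indep (fun i : base_index p => U (tag i) (tagged i));
  H1_vertex : forall t m, is_vertex t ->
    (forall t', is_vertex t' -> t' != t -> vanishes_on (U t m) t') /\
    (forall t', is_edge t' || is_face t' -> ~~ neighbouring t t' ->
       vanishes_on (U t m) t');
  H1_edge : forall t m, is_edge t ->
    (forall t', is_edge t' -> t' != t -> vanishes_on (U t m) t') /\
    (forall t', is_face t' -> ~~ neighbouring t t' ->
       vanishes_on (U t m) t');
  H1_face : forall t m, is_face t ->
    forall t', is_face t' -> t' != t -> vanishes_on (U t m) t';
  (* the boundary of the tetrahedron is the union of its closed faces *)
  H1_cell : forall t m, is_cell t ->
    forall t', is_face t' -> vanishes_on (U t m) t'
}.

Definition template (t : polytope) : 3.-tuple 'rV[R]_3 :=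
  let e1 := e1 R in let e2 := e2 R in let e3 := e3 R in
  let s := e1 + e2 + e3 in
  match t with
  | V1 => [tuple e3; e2; e1]
  | V2 => [tuple s; e2; e1]
  | V3 => [tuple s; - e3; e1]
  | V4 => [tuple s; - e3; - e2]
  | E12 => [tuple e3; - e2; - e1]
  | E13 => [tuple e2; e3; - e1]
  | E14 => [tuple e1; e3; e2]
  | E23 => [tuple e2; s; - e1]
  | E24 => [tuple e1; s; e2]
  | E34 => [tuple e1; s; - e3]
  | F123 => [tuple e3; e2; - e1]
  | F124 => [tuple e3; e1; e2]
  | F134 => [tuple e2; e1; - e3]
  | F234 => [tuple e2; e1; s]
  | C1234 => [tuple e3; e2; e1]
  end.

(* Polynomial vector fields, as an [R]-module (row vectors of polynomials
   would form a module over the polynomial ring instead). *)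
Definition vfield : lmodType R := {ffun 'I_3 -> {mpoly R[3]}}.

Definition in_P3 (p : nat) (w : vfield) : Prop := forall j, in_P p (w j).

Definition scalar_vec (n : {mpoly R[3]}) (l : 'rV[R]_3) : vfield :=
  [ffun j => l 0 j *: n].

Definition template_product (p : nat)
    (U : forall t : polytope, 'I_(nb_base p t) -> {mpoly R[3]})
    (i : base_index p * 'I_3) : vfield :=
  scalar_vec (U (tag i.1) (tagged i.1)) (tnth (template (tag i.1)) i.2).

Definition unisolvent_NII (p : nat) (I : finType) (phi : I -> vfield) : Prop :=
  basis_of (in_P3 p) phi.

End Bases.

(* Main.v *)
(* Every triple of the template is a basis of R^3.  Hence multiplying each
   element of a basis of P^p by the three vectors of its triple gives a basis
   of [P^p]^3: componentwise, a relation between the products is a relation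
   between the scalar base functions, followed by an invertible 3 x 3 system
   for each of them.  The base functions of U^p form a basis of P^p because
   they are linearly independent and as numerous as the monomials of degree at
   most p. *)
Require Import Defs.
From mathcomp Require Import all_boot all_order all_algebra.
From mathcomp Require Import reals.
From mathcomp Require Import mpoly.
From mathcomp Require Import zify lra.
Set Implicit Arguments.
Unset Strict Implicit.
Unset Printing Implicit Defensive.
Import GRing.Theory.
Local Open Scope ring_scope.

(** Exponent tuples inject into the [n]-tuples over ['I_d.+1] of sum at most [d], which stars and
    bars counts. It bounds the number of columns of the coefficient matrix used below. *)
Lemma card_bmultinom_le (n d : nat) :
  (#|{: 'X_{1..n < d.+1}}| <= 'C(n + d, n))%N.
Proof.
have le_m (m : 'X_{1..n < d.+1}) (i : 'I_n) : (m i <= d)%N.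
  by rewrite -ltnS (leq_ltn_trans _ (bmdeg m))// mdegE (bigD1 i) //= leq_addr.
(* By [le_m] each exponent fits in ['I_d.+1], so [inord] never falls back to its default. *)
pose f (m : 'X_{1..n < d.+1}) : n.-tuple 'I_d.+1 := [tuple inord (m i) | i < n].
have f_inj : injective f.
  move=> m1 m2 /(congr1 (fun t i => val (tnth t i))) eq_f.
  apply/val_inj/mnmP => i; have := congr1 (@^~ i) eq_f.
  by rewrite /= !tnth_mktuple !inordK ?ltnS.
rewrite -card_partial_ord_partitions -(card_codom f_inj).
apply/subset_leq_card/subsetP => _ /codomP[m ->].
rewrite inE -ltnS big_tuple; apply: leq_ltn_trans (bmdeg m).
rewrite mdegE leq_sum // => i _.
by rewrite tnth_mktuple inordK ?ltnS.
Qed.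

Section PolynomialVectorFields.
Variable R : realType.

Lemma lin_indep_basis_of_P (p : nat) (I : finType) (v : I -> {mpoly R[3]}) :
  (forall i, in_P p (v i)) -> lin_indep v -> ('C(p + 3, 3) <= #|I|)%N ->
  Defs.basis_of (in_P p) v.
Proof.
move=> vP v_free leI; split=> // w wP.
pose mon (j : 'I_#|{: 'X_{1..3 < p.+1}}|) : 'X_{1..3 < p.+1} := enum_val j.
pose coords (q : {mpoly R[3]}) := \row_j q@_(mon j).
(* Only monomials of degree at most [p] are recorded, so [coords] is faithful on [in_P p] alone;
   each use needs a degree bound. *)
have coords_inj q : in_P p q -> coords q = 0 -> q = 0.
  move=> qP q0; rewrite (mpolywE qP) big1 // => m _.
  have /rowP/(_ (enum_rank m)) := q0.
  by rewrite !mxE /mon enum_rankK => ->; rewrite scale0r.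
pose A := \matrix_(i < #|I|) coords (v (enum_val i)).
pose comb (c : 'rV[R]_#|I|) := \sum_i c 0 (enum_rank i) *: v i.
have combP c : in_P p (comb c).
  apply: (leq_trans (msize_sum _ _ _)); apply/bigmax_leqP => i _.
  exact: leq_trans (msizeZ_le _ _) (vP i).
have coords_comb c : coords (comb c) = c *m A.
  apply/rowP => j; rewrite !mxE raddf_sum /=.
  rewrite (reindex (@enum_val I I)); last exact/onW_bij/enum_val_bij.
  by apply: eq_bigr => i _; rewrite !mxE mcoeffZ enum_valK.
have A_free : row_free A.
  apply: inj_row_free => c cA; apply/rowP => i; rewrite mxE.
  have := v_free _ (coords_inj _ (combP c) _) (enum_val i).
  by rewrite enum_valK; apply; rewrite coords_comb.
(* The rank of [A] is its number of rows, [#|I|], which is at least its number of columns. *)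
have A_full : row_full A.
  rewrite -col_leq_rank (eqP A_free) (leq_trans (card_bmultinom_le _ _)) //.
  by rewrite addnC.
have /submxP[c def_w] : (coords w <= A)%MS by rewrite submx_full.
exists (fun i => c 0 (enum_rank i)); apply/eqP; rewrite -subr_eq0; apply/eqP.
apply: coords_inj.
  by rewrite /in_P (leq_trans (msizeD_le _ _)) // msizeN geq_max wP combP.
have -> : coords (w - comb c) = coords w - coords (comb c).
  by apply/rowP => j; rewrite !mxE mcoeffB.
by rewrite coords_comb def_w subrr.
Qed.

Lemma basis_of_scalar_vec (p : nat) (I : finType) (v : I -> {mpoly R[3]})
    (l : I -> 'I_3 -> 'rV[R]_3) :
  Defs.basis_of (in_P p) v -> (forall i, \matrix_k l i k \in unitmx) ->
  Defs.basis_of (@in_P3 R p)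
    (fun ik : I * 'I_3 => scalar_vec (v ik.1) (l ik.1 ik.2)).
Proof.
move=> [vP v_free v_span]; pose T i := \matrix_k l i k => T_unit.
(* Grouping the terms by [i] turns each component into a scalar combination of the [v i], so
   freeness and spanning of [v] apply one component at a time. *)
have combE (c : I * 'I_3 -> R) j :
    (\sum_ik c ik *: scalar_vec (v ik.1) (l ik.1 ik.2)) j =
    \sum_i (\row_k c (i, k) *m T i) 0 j *: v i.
  rewrite sum_ffunE; under [RHS]eq_bigr do rewrite mxE scaler_suml.
  rewrite pair_bigA; apply: eq_bigr => -[i k] _.
  by rewrite !ffunE !mxE scalerA.
split.
- by move=> [i k] j; rewrite ffunE; apply: leq_trans (msizeZ_le _ _) (vP i).
- move=> c c0 [i k].
  have cT : \row_k c (i, k) *m T i = 0.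
    apply/rowP => j; rewrite [RHS]mxE.
    apply: (v_free (fun i => (\row_k c (i, k) *m T i) 0 j)).
    by rewrite -combE c0 ffunE.
  have /rowP/(_ k) : \row_k c (i, k) = 0.
    by rewrite -(mulmxK (T_unit i) (\row_k _)) cT mul0mx.
  by rewrite !mxE.
- move=> w wP; have /fin_all_exists[d def_w] j := v_span (w j) (wP j).
  (* For each [i], the coefficients of [v i] in the three components of [w] form a vector,
     re-expanded here in the basis [l i] of R^3. *)
  exists (fun ik => (\row_j d j ik.1 *m invmx (T ik.1)) 0 ik.2).
  apply/ffunP => j; rewrite combE def_w; apply: eq_bigr => i _.
  have -> : \row_k (\row_j d j i *m invmx (T i)) 0 k =
            \row_j d j i *m invmx (T i).
    by apply/rowP => k; rewrite mxE.
  by rewrite (mulmxKV (T_unit i)) mxE.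
Qed.

Lemma template_unitmx (t : polytope) :
  \matrix_k tnth (template R t) k \in unitmx.
Proof.
rewrite -row_free_unit; apply: inj_row_free => c c0.
have sum3 (F : 'I_3 -> R) : \sum_k F k = F 0 + F 1 + F 2%:R.
  rewrite !big_ord_recl big_ord0 addr0 addrA.
  by congr (F _ + F _ + F _); apply/val_inj.
have {}c0 j : \sum_k c 0 k * tnth (template R t) k 0 j = 0.
  have /rowP/(_ j) := c0; rewrite [LHS]mxE [RHS]mxE => cj.
  by rewrite -[RHS]cj; apply: eq_bigr => k _; rewrite mxE.
suff [c00 c01 c02] : [/\ c 0 0 = 0, c 0 1 = 0 & c 0 2%:R = 0].
  apply/rowP => k; rewrite mxE; case: k => -[|[|[|//]]] k3.
  - by rewrite -[RHS]c00; congr (c _ _); apply/val_inj.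
  - by rewrite -[RHS]c01; congr (c _ _); apply/val_inj.
  - by rewrite -[RHS]c02; congr (c _ _); apply/val_inj.
(* For each polytope this is an explicit homogeneous system of three equations with coefficients 0,
   1 or -1. *)
move: (c0 0) (c0 1) (c0 2%:R); rewrite !sum3.
by case: t {c0}; rewrite /tnth /= !mxE /=; split; lra.
Qed.

End PolynomialVectorFields.

Theorem theorem4p1 (R : realType) (p : nat) (hp : (1 <= p)%N)
    (U : forall t : polytope, 'I_(nb_base p t) -> {mpoly R[3]})
    (hU : H1_basis U) :
  unisolvent_NII p (template_product U).
Proof.
have UB : Defs.basis_of (in_P p)
    (fun i : base_index p => U (tag i) (tagged i)).
  apply: lin_indep_basis_of_P => [i||]; first exact: (H1_degree hU).
    exact: (H1_lin_indep hU).
  (* Both sides become truncated quotients by 3! = 6, so comparing numerators suffices. *)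
  rewrite card_base_index // bin_ffactd !ffactnS ffactn0 muln1.
  by apply: leq_div2r; rewrite mulnA leq_mul //; lia.
exact: (basis_of_scalar_vec UB (fun i => template_unitmx R (tag i))).
Qed.
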